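(* Assume there is a positive constant $K$ such that $a_{j,k}\le Kjk$ for all positive integers $j,k$. Let $c_0\in X_1^+$. Then there is at least one solution $c$ of the RBK system with initial condition $c(0)=c_0$, defined on $[0,T)$ for some $T\in(0,+\infty]$.
   Context: The rate coefficients $a_{j,k}$ ($j,k\in\mathbb N=\{1,2,\dots\}$) are real with $a_{j,k}=a_{k,j}\ge 0$. The Redner--Ben-Avraham--Kahng (RBK) system is $$\frac{dc_j}{dt}=\sum_{k=1}^\infty a_{j+k,k}c_{j+k}c_k-\sum_{k=1}^\infty a_{j,k}c_jc_k,\qquad j\in\mathbb N.$$ For $\mu\ge 0$, $X_\mu=\{x=(x_j)\in\mathbb R^{\mathbb N}: \|x\|_\mu:=\sum_{j=1}^\infty j^\mu|x_j|<\infty\}$ and $X_\mu^+=\{x\in X_\mu: x_j\ge 0\ \forall j\}$. Definition (solution). Let $T\in(0,+\infty]$. A (mild) solution of the RBK system on $[0,T)$ with $c(0)=c_0\in X_1^+$ is a function $c=(c_j):[0,T)\to X_1^+$ such that: (i) each $c_j:[0,T)\to[0,\infty)$ is continuous and $\sup_{t\in[0,T)}\|c(t)\|_1<\infty$; (ii) for all $j\in\mathbb N$ and $t\in[0,T)$, $\int_0^t\sum_{k=1}^\infty a_{j,k}c_k(s)\,ds<\infty$; (iii) for all $j\in\mathbb N$ and $t\in[0,T)$, $$c_j(t)=c_{0j}+\int_0^t\Big[\sum_{k=1}^\infty a_{j+k,k}c_{j+k}(s)c_k(s)-\sum_{k=1}^\infty a_{j,k}c_j(s)c_k(s)\Big]ds.$$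 *)

(* Defs.v *)
From mathcomp Require Import all_boot all_order all_algebra.
From mathcomp Require Import all_classical all_reals all_analysis.

Set Implicit Arguments.
Unset Strict Implicit.
Unset Printing Implicit Defensive.

Import Order.TTheory GRing.Theory Num.Theory.
Import numFieldNormedType.Exports.

Local Open Scope classical_set_scope.
Local Open Scope ring_scope.

(* Sequences indexed by {1, 2, ...} are functions nat -> R whose value at 0 is
   never used: every sum starts at 1 and every quantified index is positive. *)

Definition Xnorm (R : realType) (mu : R) (x : nat -> R) : \bar R :=
  (\sum_(1 <= j <oo) ((j%:R `^ mu) * `|x j|)%:E)%E.

Definition X (R : realType) (mu : R) : set (nat -> R) :=
  [set x | (Xnorm mu x < +oo)%E].

Definition Xplus (R : realType) (mu : R) : set (nat -> R) :=
  [set x | X mu x /\ forall j : nat, (0 < j)%N -> 0 <= x j].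

(* Gain minus loss.  The value is extended real, so that no convergence of the
   two series is presupposed. *)
Definition rbk_rhs (R : realType) (a : nat -> nat -> R) (x : nat -> R)
    (j : nat) : \bar R :=
  (\sum_(1 <= k <oo) (a (j + k)%N k * x (j + k)%N * x k)%:E
   - \sum_(1 <= k <oo) (a j k * x j * x k)%:E)%E.

Definition time_interval (R : realType) (T : \bar R) : set R :=
  [set t | 0 <= t /\ (t%:E < T)%E].

(* Values of c at times outside [0, T) are irrelevant.  Since \bar R sets
   +oo - oo = -oo, both inside rbk_rhs and between the integrals of the positive
   and negative parts, the last clause forces, for each j and t, the integrand
   to be finite for almost every s and Lebesgue integrable on [0, t]. *)
Record rbk_solution (R : realType) (a : nat -> nat -> R) (c0 : nat -> R)
    (T : \bar R) (c : R -> nat -> R) : Prop := RBKSolution {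
  rbk_init : forall j : nat, (0 < j)%N -> c 0 j = c0 j ;
  rbk_Xplus : forall t : R, time_interval T t -> Xplus 1 (c t) ;
  rbk_continuous : forall j : nat, (0 < j)%N ->
    {within time_interval T, continuous (fun t : R => c t j)} ;
  rbk_bounded :
    (ereal_sup [set Xnorm 1 (c t) | t in time_interval T] < +oo)%E ;
  rbk_rate_integrable : forall (j : nat) (t : R), (0 < j)%N ->
    time_interval T t ->
    (\int[lebesgue_measure]_(s in `[0%R, t])
       (\sum_(1 <= k <oo) (a j k * c s k)%:E) < +oo)%E ;
  rbk_mild : forall (j : nat) (t : R), (0 < j)%N -> time_interval T t ->
    ((c t j)%:E =
      (c0 j)%:E + \int[lebesgue_measure]_(s in `[0%R, t]) rbk_rhs a (c s) j)%E
}.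

(* Main.v *)
(* Reactions only produce clusters smaller than the larger reactant, so for
   every m the tail sum_(j >= m) j c_j cannot increase.  The explicit Euler
   scheme for the system truncated to sizes <= n + 1, with a step small enough
   to keep it nonnegative, inherits this: all iterates satisfy
   sum_(j >= m) j c_j <= tau m, with tau m -> 0 the tail of the initial datum.
   On this set the right-hand side is bounded and uniformly continuous for
   componentwise convergence, because a_(j,k) <= K j k makes the tails of the
   series at most K (tau 1) (tau m).  Hence the approximations are Lipschitz in
   time up to the step size.  Their limit along an ultrafilter of indices exists
   pointwise without extracting subsequences, and the difference quotients,
   uniformly close to the right-hand side, pass to this limit; so the limit is
   differentiable and the fundamental theorem of calculus gives the integral
   equation, on [0, +oo). *)
Require Import Defs.
From mathcomp Require Import all_boot all_order all_algebra.
From mathcomp Require Import all_classical all_reals all_analysis.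
From mathcomp Require Import measurable_realfun ring lra.
Import Order.TTheory GRing.Theory Num.Theory.
Import numFieldNormedType.Exports.
Local Open Scope classical_set_scope.
Local Open Scope ring_scope.

(** * Truncated rates on sequences with controlled tails *)

Section TruncatedRates.
Context {R : realType}.
Variable a : nat -> nat -> R.

(** The cut concerns [k] alone: these are partial sums of the two series in [rbk_rhs], and on
    sequences vanishing from [p] on they are the full sums. *)
Definition gain (p : nat) (x : nat -> R) (j : nat) : R :=
  \sum_(1 <= k < p) a (j + k)%N k * x (j + k)%N * x k.

Definition loss (p : nat) (x : nat -> R) (j : nat) : R :=
  \sum_(1 <= k < p) a j k * x j * x k.

Definition rate (p : nat) (x : nat -> R) (j : nat) : R :=
  gain p x j - loss p x j.

(** Finite partial sums keep the tail bounds free of convergence questions and stable under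
    componentwise limits; [m = 1] bounds the total mass. *)
Definition dominated (tau : nat -> R) (x : nat -> R) : Prop :=
  (forall j, (0 < j)%N -> 0 <= x j) /\
  forall m p, (0 < m)%N -> \sum_(m <= j < p) j%:R * x j <= tau m.

Section Dominated.
Variables (tau x : nat -> R).
Hypothesis dx : dominated tau x.

Lemma dominated_ge0 j : (0 < j)%N -> 0 <= x j.
Proof. exact: dx.1. Qed.

Lemma dominated_tau_ge0 m : (0 < m)%N -> 0 <= tau m.
Proof. by move=> m0; have := dx.2 m m m0; rewrite big_geq. Qed.

Lemma dominated_mass j : (0 < j)%N -> j%:R * x j <= tau 1%N.
Proof.
move=> j0; apply: le_trans (dx.2 1%N j.+1 isT).
rewrite big_nat_recr//= lerDr big_nat_cond sumr_ge0// => i.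
by rewrite andbT => /andP[i0 _]; rewrite mulr_ge0// dominated_ge0.
Qed.

Lemma dominated_le j : (0 < j)%N -> x j <= tau 1%N.
Proof.
move=> j0; apply: le_trans (dominated_mass _ j0).
by rewrite ler_peMl ?dominated_ge0// ler1n.
Qed.

End Dominated.

Variable K : R.
Hypothesis K0 : 0 <= K.
Hypothesis a_ge0 : forall j k : nat, (0 < j)%N -> (0 < k)%N -> 0 <= a j k.
Hypothesis a_le :
  forall j k : nat, (0 < j)%N -> (0 < k)%N -> a j k <= K * j%:R * k%:R.

Section Tails.
Variables (tau x : nat -> R).
Hypothesis dx : dominated tau x.

Lemma pair_rate_ge0 i j k : (0 < i)%N -> (0 < j)%N -> (0 < k)%N ->
  0 <= a i k * x j * x k.
Proof. by move=> i0 j0 k0; rewrite !mulr_ge0 ?a_ge0 ?(dominated_ge0 _ _ dx). Qed.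

(** Each size factor of [K * j * k] goes to one concentration, and [j * x j] is at most the total
    mass, so the bound no longer depends on [j]. *)
Lemma pair_rate_le j k : (0 < j)%N -> (0 < k)%N ->
  a j k * x j * x k <= K * tau 1%N * (k%:R * x k).
Proof.
move=> j0 k0.
have xj := dominated_ge0 _ _ dx _ j0; have xk := dominated_ge0 _ _ dx _ k0.
apply: (@le_trans _ _ (K * (j%:R * x j) * (k%:R * x k))).
  have -> : K * (j%:R * x j) * (k%:R * x k) = (K * j%:R * k%:R) * x j * x k by ring.
  by rewrite !ler_wpM2r ?a_le.
rewrite ler_wpM2r ?mulr_ge0// ler_wpM2l//.
exact: dominated_mass dx _ j0.
Qed.

(** The map [u] lets one estimate serve the gain, with [u k = j + k], and the loss, with [u]
    constant. *)
Lemma pair_sum_bounds (u : nat -> nat) m p : (0 < m)%N ->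
  (forall k, (0 < k)%N -> (0 < u k)%N) ->
  0 <= \sum_(m <= k < p) a (u k) k * x (u k) * x k <= K * tau 1%N * tau m.
Proof.
move=> m0 u0; apply/andP; split.
  rewrite big_nat_cond sumr_ge0// => k; rewrite andbT => /andP[mk _].
  by apply: pair_rate_ge0; rewrite ?u0//; apply: leq_trans mk.
apply: (@le_trans _ _ (K * tau 1%N * \sum_(m <= k < p) k%:R * x k)); last first.
  by rewrite ler_wpM2l ?dx.2// mulr_ge0// (dominated_tau_ge0 _ _ dx).
rewrite mulr_sumr; apply: ler_sum_nat => k /andP[mk _].
by apply: pair_rate_le; rewrite ?u0//; apply: leq_trans mk.
Qed.

Lemma rate_tail m p j : (0 < m <= p)%N -> (0 < j)%N ->
  `|rate p x j - rate m x j| <= K * tau 1%N * tau m.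
Proof.
move=> /andP[m0 mp] j0.
rewrite /rate /gain /loss !(@big_cat_nat _ _ _ m 1 p)//=.
have /andP[] := pair_sum_bounds (fun k => j + k)%N m p m0
  (fun k k0 => ltn_addl _ k0).
have /andP[] := pair_sum_bounds (fun=> j) m p m0 (fun _ _ => j0).
set A := \sum_(m <= k < p) a j k * _ * _; set B := \sum_(m <= k < p) _.
move=> A0 A1 B0 B1.
(* The gain tail [B] and the loss tail [A] lie in the same interval starting at 0, so their
   difference costs the bound only once. *)
by rewrite ler_norml; apply/andP; split; lra.
Qed.

Lemma rate_bound p j : (0 < j)%N -> `|rate p x j| <= K * tau 1%N * tau 1%N.
Proof.
move=> j0; case: p => [|p].
  rewrite /rate /gain /loss !big_geq// subrr normr0.
  by rewrite !mulr_ge0// (dominated_tau_ge0 _ _ dx).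
have := @rate_tail 1%N p.+1 j isT j0.
by rewrite [X in _ - X]/rate /gain /loss !(@big_geq _ _ _ 1 1)// !subr0.
Qed.

End Tails.

(** Beyond a cut [m] the rates of [x] and [y] change little, by [rate_tail]; before it they are
    polynomials in finitely many components, Lipschitz on the dominated set. Uniformity in [p]
    serves later, when truncation and argument vary together. *)
Lemma rate_modulus (tau : nat -> R) (j : nat) (e : R) :
  tau @ \oo --> 0 -> (0 < j)%N -> 0 < e ->
  exists M, exists2 d : R, 0 < d &
    forall x y p, dominated tau x -> dominated tau y ->
    (forall k, (0 < k < M)%N -> `|x k - y k| <= d) ->
    `|rate p x j - rate p y j| <= e.
Proof.
move=> tau0 j0 e0.
(* The sign of [tau 1] comes from the existence of a dominated sequence; without one the claim is
   vacuous. *)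
have [[x0 dx0]|nodom] := pselect (exists x, dominated tau x); last first.
  by exists 0%N, 1 => // x y p dx; exfalso; apply: nodom; exists x.
have t1 : 0 <= tau 1%N := dominated_tau_ge0 _ _ dx0 1%N isT.
have Kt : 0 <= K * tau 1%N by rewrite mulr_ge0.
(* The two tails take [e / 4] each, which leaves [e / 2] for the head. *)
have [m m0 mtail] : exists2 m, (0 < m)%N & K * tau 1%N * tau m <= e / 4.
  have : (fun m => K * tau 1%N * tau m) @ \oo --> K * tau 1%N * 0.
    by apply: cvgM => //; exact: cvg_cst.
  rewrite mulr0 => /cvgrPdist_le /(_ (e / 4)).
  case=> [|N _ /(_ N.+1 (leqnSn _))]; first by lra.
  by rewrite sub0r normrN => /(le_trans (ler_norm _)) h; exists N.+1.
pose C := \sum_(1 <= k < m) (a (j + k)%N k + a j k) * (2 * tau 1%N).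
have C0 : 0 <= C.
  rewrite /C big_nat_cond sumr_ge0// => k; rewrite andbT => /andP[k0 _].
  by rewrite mulr_ge0 ?mulr_ge0// addr_ge0 ?a_ge0// ltn_addl.
have dist2 (u u' v v' d : R) : 0 <= u <= tau 1%N -> 0 <= v' <= tau 1%N ->
    `|u - u'| <= d -> `|v - v'| <= d -> `|u * v - u' * v'| <= 2 * tau 1%N * d.
  move=> /andP[ua ub] /andP[va vb] hu hv.
  have -> : u * v - u' * v' = u * (v - v') + v' * (u - u') by ring.
  apply: le_trans (ler_normD _ _) _; rewrite !normrM (ger0_norm ua) (ger0_norm va).
  have := ler_pM ua (normr_ge0 _) ub hv; have := ler_pM va (normr_ge0 _) vb hu.
  lra.
have head x y d : dominated tau x -> dominated tau y -> 0 <= d ->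
    (forall k, (0 < k < j + m)%N -> `|x k - y k| <= d) -> forall p, (p <= m)%N ->
    `|rate p x j - rate p y j| <= C * d.
  move=> dx dy d0 xyd p pm.
  have bx k : (0 < k)%N -> 0 <= x k <= tau 1%N.
    by move=> k0; rewrite (dominated_ge0 _ _ dx)// (dominated_le _ _ dx).
  have by' k : (0 < k)%N -> 0 <= y k <= tau 1%N.
    by move=> k0; rewrite (dominated_ge0 _ _ dy)// (dominated_le _ _ dy).
  rewrite /rate /gain /loss -!sumrB.
  apply: le_trans (ler_norm_sum _ _ _) _.
  apply: (@le_trans _ _
      (\sum_(1 <= k < p) (a (j + k)%N k + a j k) * (2 * tau 1%N) * d)).
    apply: ler_sum_nat => k /andP[k0 kp].
    have jk0 : (0 < j + k)%N by rewrite ltn_addl.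
    have km := leq_trans kp pm.
    have xydj : `|x j - y j| <= d by rewrite xyd// j0 -ltn_subLR ?subnn.
    have xydk : `|x k - y k| <= d by rewrite xyd// k0 ltn_addl.
    have xydjk : `|x (j + k)%N - y (j + k)%N| <= d by rewrite xyd// jk0 ltn_add2l.
    set A := a (j + k)%N k; set B := a j k.
    have A0 : 0 <= A by rewrite a_ge0.
    have B0 : 0 <= B by rewrite a_ge0.
    have -> : A * x (j + k)%N * x k - B * x j * x k
       - (A * y (j + k)%N * y k - B * y j * y k) =
       A * (x (j + k)%N * x k - y (j + k)%N * y k)
       - B * (x j * x k - y j * y k) by ring.
    apply: le_trans (ler_normB _ _) _.
    rewrite !normrM (ger0_norm A0) (ger0_norm B0).
    have h1 := dist2 _ _ _ _ _ (bx _ jk0) (by' _ k0) xydjk xydk.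
    have h2 := dist2 _ _ _ _ _ (bx _ j0) (by' _ k0) xydj xydk.
    have := ler_wpM2l A0 h1; have := ler_wpM2l B0 h2; lra.
  rewrite -mulr_suml ler_wpM2r// /C.
  have [p1|p1] := leqP p 1.
    by rewrite big_geq// (le_trans _ C0).
  rewrite (@big_cat_nat _ _ _ p 1 m)//=; last exact: ltnW.
  rewrite lerDl big_nat_cond sumr_ge0// => k; rewrite andbT => /andP[pk _].
  have k0 : (0 < k)%N by apply: leq_trans pk; apply: ltnW.
  by rewrite mulr_ge0 ?mulr_ge0// addr_ge0 ?a_ge0// ltn_addl.
(* The gain with [k < m] reads components up to [j + m - 1]; the [+ 1] guards against [C = 0]. *)
exists (j + m)%N, (e / 2 / (C + 1)); first by rewrite !divr_gt0//; lra.
have d0 : 0 <= e / 2 / (C + 1) by rewrite !divr_ge0//; lra.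
move=> x y p dx dy xyd.
have Cd : C * (e / 2 / (C + 1)) <= e / 2.
  rewrite mulrCA ler_piMr; [by []|lra|].
  by rewrite ler_pdivrMr ?mul1r; lra.
have [pm|mp] := leqP p m.
  by have := head _ _ _ dx dy d0 xyd p pm; lra.
have mp' : (0 < m <= p)%N by rewrite m0 ltnW.
have := rate_tail _ _ dx m p j mp' j0; have := rate_tail _ _ dy m p j mp' j0.
have := head _ _ _ dx dy d0 xyd m (leqnn _).
rewrite !ler_norml; lra.
Qed.

End TruncatedRates.

(** * The explicit Euler scheme and its invariant set *)

Section EulerScheme.
Context {R : realType}.
Variables (a : nat -> nat -> R) (N : nat).

Definition supported (x : nat -> R) : Prop := forall j, (N <= j)%N -> x j = 0.

Definition euler_step (h : R) (x : nat -> R) : nat -> R :=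
  fun j => x j + h * rate a N x j.

Definition euler (h : R) (x0 : nat -> R) (i : nat) : nat -> R :=
  iter i (euler_step h) x0.

Lemma euler_step_supported h x : supported x -> supported (euler_step h x).
Proof.
move=> sx j Nj; rewrite /euler_step /rate /gain /loss sx//.
rewrite !big1 ?subrr ?mulr0 ?addr0// => k _; first by rewrite mulr0 mul0r.
by rewrite sx ?mulr0 ?mul0r// (leq_trans Nj) ?leq_addr.
Qed.

(** Each unit shift drops a nonnegative first term and brings in a term at an index at least [N],
    where [phi] vanishes. *)
Lemma sum_shift_le (phi : nat -> R) k :
  (forall i, (0 < i)%N -> 0 <= phi i) -> (forall i, (N <= i)%N -> phi i = 0) ->
  \sum_(1 <= j < N) phi (j + k)%N <= \sum_(1 <= j < N) phi j.
Proof.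
move=> phi0 phiN; elim: k => [|k IHk].
  by rewrite le_eqVlt; apply/orP; left; apply/eqP/eq_bigr => j _; rewrite addn0.
apply: le_trans IHk.
have [N1|N1] := leqP N 1; first by rewrite !big_geq.
under eq_bigr do rewrite addnS -addSn.
rewrite -(big_add1 _ _ _ N.+1 xpredT (fun i => phi (i + k)%N))/=.
rewrite big_nat_recr//= phiN ?leq_addr// addr0.
rewrite [leRHS]big_ltn//= lerDr phi0//.
Qed.

(* Every reaction of the pair (p, k) with k < p replaces the weight g p + g k
   by g (p - k) <= g p, so discarding the loss of k only helps. *)
Lemma weighted_rate_le0 (g x : nat -> R) :
  (forall j k : nat, (0 < j)%N -> (0 < k)%N -> 0 <= a j k) ->
  (forall j, 0 <= g j) -> {homo g : i j / (i <= j)%N >-> i <= j} ->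
  (forall j, (0 < j)%N -> 0 <= x j) -> supported x ->
  \sum_(1 <= j < N) g j * rate a N x j <= 0.
Proof.
move=> a_ge0 g0 gmono x0 sx.
under eq_bigr do rewrite /rate mulrBr.
rewrite sumrB subr_le0 /gain /loss.
under eq_bigr do rewrite mulr_sumr.
under [leRHS]eq_bigr do rewrite mulr_sumr.
rewrite exchange_big/= [leRHS]exchange_big/=.
apply: ler_sum_nat => k /andP[k0 _].
pose phi i := g i * (a i k * x i * x k).
apply: le_trans (sum_shift_le phi k _ _).
- apply: ler_sum_nat => j /andP[j0 _]; rewrite /phi ler_wpM2r ?gmono ?leq_addr//.
  by rewrite !mulr_ge0 ?a_ge0 ?x0// ltn_addr.
- by move=> i i0; rewrite /phi !mulr_ge0 ?a_ge0 ?x0.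
- by move=> i Ni; rewrite /phi sx// mulr0 mul0r mulr0.
Qed.

Section Invariance.
Variables (K : R) (tau : nat -> R) (h : R).
Hypothesis K0 : 0 <= K.
Hypothesis a_ge0 : forall j k : nat, (0 < j)%N -> (0 < k)%N -> 0 <= a j k.
Hypothesis a_le :
  forall j k : nat, (0 < j)%N -> (0 < k)%N -> a j k <= K * j%:R * k%:R.
Hypothesis h0 : 0 <= h.
(* Step size condition under which the explicit scheme stays nonnegative. *)
Hypothesis hN : h * (N%:R * (K * tau 1%N)) <= 1.

(** Turns a tail into a sum against a nondecreasing weight, the form that [weighted_rate_le0]
    handles. *)
Lemma sum_tail_weight (x : nat -> R) m p : (0 < m)%N ->
  \sum_(m <= j < p) j%:R * x j =
  \sum_(1 <= j < p) (if (m <= j)%N then j%:R else 0) * x j.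
Proof.
move=> m0; rewrite (@big_nat_widenl _ _ _ m 1)//= big_mkcond/=.
by apply: eq_bigr => j _; case: ifP; rewrite ?mul0r.
Qed.

Lemma dominated_supported (x : nat -> R) :
  (forall j, (0 < j)%N -> 0 <= x j) -> supported x ->
  (forall m, (0 < m)%N -> \sum_(m <= j < N) j%:R * x j <= tau m) ->
  dominated tau x.
Proof.
move=> x0 sx xtau; split=> // m p m0; apply: le_trans (xtau m m0).
have [pN|Np] := leqP p N.
  have [pm|mp] := leqP p m.
    rewrite big_geq// big_nat_cond sumr_ge0// => j; rewrite andbT => /andP[mj _].
    by rewrite mulr_ge0// x0// (leq_trans m0).
  rewrite (@big_cat_nat _ _ _ p m N)//=; last exact: ltnW.
  rewrite lerDl big_nat_cond sumr_ge0// => j; rewrite andbT => /andP[pj _].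
  by rewrite mulr_ge0// x0// (leq_trans m0)// (leq_trans (ltnW mp)).
have [Nm|mN] := leqP N m.
  rewrite big_nat_cond big1 ?[leRHS]big_geq// => j; rewrite andbT => /andP[mj _].
  by rewrite sx ?mulr0// (leq_trans Nm).
rewrite (@big_cat_nat _ _ _ N m p)//=; [|exact: ltnW|exact: ltnW].
rewrite [X in _ + X]big_nat_cond [X in _ + X]big1 ?addr0// => j.
by rewrite andbT => /andP[Nj _]; rewrite sx ?mulr0.
Qed.

(** The loss is [x j] times a factor at most [N * (K * tau 1)] when [j < N], so by [hN] one step
    removes at most [x j], and the gain only adds. The tails do not increase because of
    [weighted_rate_le0]. *)
Lemma euler_step_dominated x : supported x -> dominated tau x ->
  dominated tau (euler_step h x).
Proof.
move=> sx dx; apply: dominated_supported.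
- move=> j j0; have [Nj|jN] := leqP N j.
    by rewrite (euler_step_supported _ _ sx).
  have xj := dominated_ge0 _ _ dx _ j0.
  have lossle : loss a N x j <= x j * (N%:R * (K * tau 1%N)).
    have -> : loss a N x j = x j * \sum_(1 <= k < N) a j k * x k.
      by rewrite /loss mulr_sumr; apply: eq_bigr => k _; ring.
    rewrite ler_wpM2l//.
    apply: (@le_trans _ _ (N%:R * K * \sum_(1 <= k < N) k%:R * x k)).
      rewrite mulr_sumr; apply: ler_sum_nat => k /andP[k0 _].
      rewrite mulrA ler_wpM2r ?(dominated_ge0 _ _ dx)//.
      apply: le_trans (a_le _ _ j0 k0) _.
      by rewrite ler_wpM2r// mulrC ler_wpM2r// ler_nat ltnW.
    by rewrite mulrA ler_wpM2l ?mulr_ge0// dx.2.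
  have gain0 : 0 <= gain a N x j.
    rewrite /gain big_nat_cond sumr_ge0// => k; rewrite andbT => /andP[k0 _].
    by rewrite (pair_rate_ge0 _ a_ge0 _ _ dx)// ltn_addl.
  rewrite /euler_step /rate.
  have := ler_wpM2l h0 lossle; have := ler_wpM2l xj hN.
  have := mulr_ge0 h0 gain0; lra.
- exact: euler_step_supported.
- move=> m m0; rewrite sum_tail_weight// /euler_step.
  under eq_bigr do rewrite mulrDr mulrCA.
  rewrite big_split/= -sum_tail_weight// -mulr_sumr.
  apply: (@le_trans _ _ (tau m + 0)); last by rewrite addr0.
  rewrite lerD ?dx.2// mulr_ge0_le0//.
  apply: weighted_rate_le0 => //.
  + by move=> j; case: ifP.
  + move=> i j ij; case: ifP => mi; first by rewrite (leq_trans mi ij) ler_nat.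
    by case: ifP.
  + exact: dx.1.
Qed.

Variable x0 : nat -> R.
Hypothesis sx0 : supported x0.
Hypothesis dx0 : dominated tau x0.

Lemma euler_dominated i : dominated tau (euler h x0 i).
Proof.
suff: supported (euler h x0 i) /\ dominated tau (euler h x0 i) by case.
elim: i => [|i [IHs IHd]]; first by split.
split; first exact: euler_step_supported.
exact: euler_step_dominated.
Qed.

Lemma euler_subE (i1 i2 j : nat) : (i1 <= i2)%N ->
  euler h x0 i2 j - euler h x0 i1 j =
  \sum_(i1 <= l < i2) h * rate a N (euler h x0 l) j.
Proof.
move=> i12; rewrite -(telescope_sumr (fun i => euler h x0 i j))//.
by apply: eq_bigr => l _; rewrite /= /euler_step addrAC subrr add0r.
Qed.

Lemma euler_lipschitz (i1 i2 j : nat) : (0 < j)%N -> (i1 <= i2)%N ->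
  `|euler h x0 i2 j - euler h x0 i1 j| <=
  (i2 - i1)%:R * h * (K * tau 1%N * tau 1%N).
Proof.
move=> j0 i12; rewrite euler_subE//.
apply: le_trans (ler_norm_sum _ _ _) _.
apply: (@le_trans _ _ (\sum_(i1 <= l < i2) h * (K * tau 1%N * tau 1%N))).
  apply: ler_sum => l _; rewrite normrM (ger0_norm h0) ler_wpM2l//.
  by apply: rate_bound => //; exact: euler_dominated.
by rewrite sumr_const_nat -[leRHS]mulrA mulr_natl.
Qed.

(** The reference index [i] may be either end of the range, so the estimate serves both one-sided
    difference quotients. *)
Lemma euler_increment (e : R) (i1 i i2 j : nat) :
  (0 < j)%N -> (i1 <= i <= i2)%N ->
  (forall l, (i1 <= l < i2)%N ->
     `|rate a N (euler h x0 l) j - rate a N (euler h x0 i) j| <= e) ->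
  `|euler h x0 i2 j - euler h x0 i1 j
    - (i2 - i1)%:R * h * rate a N (euler h x0 i) j| <= (i2 - i1)%:R * h * e.
Proof.
move=> j0 /andP[i1i ii2] He; rewrite euler_subE ?(leq_trans i1i)//.
have -> : (i2 - i1)%:R * h * rate a N (euler h x0 i) j =
    \sum_(i1 <= l < i2) h * rate a N (euler h x0 i) j.
  by rewrite sumr_const_nat -mulrA mulr_natl.
rewrite -sumrB; apply: le_trans (ler_norm_sum _ _ _) _.
apply: (@le_trans _ _ (\sum_(i1 <= l < i2) h * e)).
  apply: ler_sum_nat => l il; rewrite -mulrBr normrM (ger0_norm h0).
  by rewrite ler_wpM2l// He.
by rewrite sumr_const_nat -[leRHS]mulrA mulr_natl.
Qed.

End Invariance.
End EulerScheme.

(** * Ultrafilter limits, rounding to the time grid, nonnegative series *)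

(** The image of an ultrafilter is again one, and on a compact segment every ultrafilter
    converges. *)
Lemma ultra_bounded_cvg {R : realType} {I : Type} (U : set_system I)
    (u : I -> R) (m M : R) :
  UltraFilter U -> (forall i, m <= u i <= M) -> u i @[i --> U] --> lim (u @ U).
Proof.
move=> UU um.
have UuU : UltraFilter (u @ U).
  have uP : ProperFilter (u @ U) by exact: fmap_proper_filter.
  split=> // G GP uG.
  apply/seteqP; split=> // A GA.
  have [//|UA] := in_ultra_setVsetC (u @^-1` A) UU.
  have /filter_ex[x [Ax nAx]] : G (A `&` ~` A) by apply: filterI => //; exact: uG.
  by case: nAx.
have := @segment_compact R m M.
rewrite compact_ultra => /(_ (u @ U) UuU).
case=> [|l [_ ul]]; last exact: cvgP ul.
by apply: (@filterE _ U) => i; rewrite /= in_itv; exact: um.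
Qed.

Section Truncn.
Context {R : realType}.
Variables (h s t : R).
Hypotheses (h0 : 0 < h) (st : s <= t).

Lemma truncn_div_le : (Num.truncn (s / h) <= Num.truncn (t / h))%N.
Proof. by rewrite le_truncn// ler_pM2r// invr_gt0. Qed.

Lemma truncn_div_subr_le :
  (Num.truncn (t / h) - Num.truncn (s / h))%:R * h <= t - s + h.
Proof.
rewrite natrB ?truncn_div_le//.
have hs := truncnS_gt (s / h); rewrite -natr1 ltr_pdivrMr// in hs.
have [t0|t0] := leP 0 (t / h).
  have := truncn_le (t / h); rewrite t0 ler_pdivlMr// => ht.
  lra.
(* On negative numbers [Num.truncn] is 0, so the left side is nonpositive, while [s <= t] makes the
   right side positive. *)
have -> : Num.truncn (t / h) = 0%N by apply/truncn0Pn; lra.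
have := mulr_ge0 (ler0n R (Num.truncn (s / h))) (ltW h0).
move: st h0; rewrite mulr0n sub0r mulNr; lra.
Qed.

(** The grid counts no step before time 0, whence the sign condition on [s]. *)
Lemma truncn_div_subr_ge : 0 <= s ->
  t - s - h <= (Num.truncn (t / h) - Num.truncn (s / h))%:R * h.
Proof.
move=> s0; rewrite natrB ?truncn_div_le//.
have ht := truncnS_gt (t / h); rewrite -natr1 ltr_pdivrMr// in ht.
have := truncn_le (s / h); rewrite divr_ge0 ?(ltW h0)// ler_pdivlMr// => hs.
lra.
Qed.

End Truncn.

Lemma bounded_nneseries {R : realType} (u : nat -> R) (B : R) :
  (forall k, (0 < k)%N -> 0 <= u k) ->
  (forall p, \sum_(1 <= k < p) u k <= B) ->
  cvgn (fun p => \sum_(1 <= k < p) u k) /\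
  (\sum_(1 <= k <oo) (u k)%:E)%E = (limn (fun p => \sum_(1 <= k < p) u k))%:E.
Proof.
move=> u0 uB.
have cu : cvgn (fun p => \sum_(1 <= k < p) u k).
  apply: nondecreasing_is_cvgn; last first.
    by exists B => _ [p _ <-]; exact: uB.
  apply/nondecreasing_seqP => -[|p]; first by rewrite !big_geq.
  by rewrite [leRHS]big_nat_recr//= lerDl u0.
split=> //; rewrite -EFin_lim//.
by congr (limn _); apply/funext => p; rewrite /= sumEFin.
Qed.

(** * The rate without truncation *)

Section FullRate.
Context {R : realType}.
Variables (a : nat -> nat -> R) (K : R) (tau : nat -> R).
Hypothesis K0 : 0 <= K.
Hypothesis a_ge0 : forall j k : nat, (0 < j)%N -> (0 < k)%N -> 0 <= a j k.
Hypothesis a_le :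
  forall j k : nat, (0 < j)%N -> (0 < k)%N -> a j k <= K * j%:R * k%:R.

Definition full_rate (x : nat -> R) (j : nat) : R := limn (fun p => rate a p x j).

(** Both series have nonnegative terms and bounded partial sums, so the extended real difference is
    an honest difference of finite limits. *)
Lemma rate_cvg_rbk_rhs x j : dominated tau x -> (0 < j)%N ->
  rate a p x j @[p --> \oo] --> full_rate x j /\
  rbk_rhs a x j = (full_rate x j)%:E.
Proof.
move=> dx j0.
have [|k|cg eg] := @bounded_nneseries R (fun k => a (j + k)%N k * x (j + k)%N * x k)
    (K * tau 1%N * tau 1%N).
- by move=> k k0; rewrite (pair_rate_ge0 _ a_ge0 _ _ dx)// ltn_addl.
- have /(_ _)/andP[//|_ ->//] := pair_sum_bounds a K K0 a_ge0 a_le _ _ dx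
    (fun k => j + k)%N 1%N k isT.
  by move=> i i0; rewrite ltn_addl.
have [|k|cl el] := @bounded_nneseries R (fun k => a j k * x j * x k)
    (K * tau 1%N * tau 1%N).
- by move=> k k0; rewrite (pair_rate_ge0 _ a_ge0 _ _ dx).
- by have /(_ _)/andP[//|_ ->//] := pair_sum_bounds a K K0 a_ge0 a_le _ _ dx
    (fun=> j) 1%N k isT.
rewrite /rbk_rhs eg el -EFinB.
have c : rate a p x j @[p --> \oo] -->
    limn (fun p => gain a p x j) - limn (fun p => loss a p x j).
  by apply: cvgB.
by rewrite /full_rate (cvg_lim _ c).
Qed.

Lemma full_rate_le x y j (e : R) : (0 < j)%N ->
  dominated tau x -> dominated tau y ->
  (forall p, `|rate a p x j - rate a p y j| <= e) ->
  `|full_rate x j - full_rate y j| <= e.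
Proof.
move=> j0 dx dy xye.
have [cx _] := rate_cvg_rbk_rhs _ _ dx j0.
have [cy _] := rate_cvg_rbk_rhs _ _ dy j0.
apply: (ler_cvg_to (cvg_norm (cvgB cx cy)) (cvg_cst e)).
by apply: nearW => p; exact: xye.
Qed.

(** At the same truncation [n.+1], the argument [x n] is first replaced by [y], by the modulus
    uniform in [p]; then the truncation is removed for the fixed [y]. *)
Lemma rate_cvg_full_rate (U : set_system nat) (x : nat -> nat -> R) y j :
  tau @ \oo --> 0 -> ProperFilter U -> \oo `<=` U -> (0 < j)%N ->
  (forall n, dominated tau (x n)) -> dominated tau y ->
  (forall k, (0 < k)%N -> x n k @[n --> U] --> y k) ->
  rate a n.+1 (x n) j @[n --> U] --> full_rate y j.
Proof.
move=> tau0 UP Uoo j0 dx dy xy; apply/cvgrPdist_le => e e0.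
have e20 : 0 < e / 2 by lra.
have [M [d d0 Hd]] := rate_modulus a K K0 a_ge0 a_le tau j _ tau0 j0 e20.
(* Only finitely many components matter, so a finite intersection of members of [U] controls them
   all. *)
have near_x : \forall n \near U, forall k, (0 < k < M)%N -> `|x n k - y k| <= d.
  elim: M {Hd} => [|M IHM]; first by apply: nearW => n k; rewrite andbF.
  have [->|M0] := posnP M.
    by apply: nearW => n k /andP[k0 k1]; move: k0; rewrite lt0n; case: k k1.
  have /cvgrPdist_le/(_ _ d0) := xy _ M0.
  move: IHM; apply: filterS2 => n IH hM k /andP[k0].
  rewrite ltnS leq_eqVlt => /predU1P[->|kM]; first by rewrite distrC.
  by apply: IH; rewrite k0.
have near_y : \forall n \near U, `|full_rate y j - rate a n.+1 y j| <= e / 2.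
  apply: Uoo; have [cy _] := rate_cvg_rbk_rhs _ _ dy j0.
  by have := cy; rewrite -cvg_shiftS => /cvgrPdist_le; apply.
move: near_x near_y; apply: filterS2 => n hx hy.
have := Hd _ _ n.+1 (dx n) dy hx; rewrite distrC.
move: hy; rewrite !ler_norml; lra.
Qed.

End FullRate.

(** * The limit of the Euler approximations *)

Section Limit.
Context {R : realType}.
Variables (a : nat -> nat -> R) (K : R) (tau : nat -> R) (c0 : nat -> R).
Hypothesis K0 : 0 <= K.
Hypothesis a_ge0 : forall j k : nat, (0 < j)%N -> (0 < k)%N -> 0 <= a j k.
Hypothesis a_le :
  forall j k : nat, (0 < j)%N -> (0 < k)%N -> a j k <= K * j%:R * k%:R.
Hypothesis tau0 : tau @ \oo --> 0.
Hypothesis dc0 : dominated tau c0.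

Definition cutoff (n : nat) : nat -> R := fun j => if (j < n)%N then c0 j else 0.

(** With truncation index [n.+1] this meets the stability condition of the scheme; the [+ 1] keeps
    the denominator positive. *)
Definition step_size (n : nat) : R := (n.+1%:R * (K * tau 1%N + 1))^-1.

(** Piecewise constant in time; negative times are sent to node 0. *)
Definition approx (n : nat) (t : R) : nat -> R :=
  euler a n.+1 (step_size n) (cutoff n.+1) (Num.truncn (t / step_size n)).

Let tau1_ge0 : 0 <= tau 1%N.
Proof. exact: dominated_tau_ge0 _ _ dc0 _ _. Qed.

Let Ktau_ge0 : 0 <= K * tau 1%N.
Proof. by rewrite mulr_ge0. Qed.

Let L := K * tau 1%N * tau 1%N.

Let L_ge0 : 0 <= L.
Proof. by rewrite mulr_ge0. Qed.

Lemma step_size_gt0 n : 0 < step_size n.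
Proof. by rewrite invr_gt0 mulr_gt0// ltr_wpDl. Qed.

Lemma step_size_stable n : step_size n * (n.+1%:R * (K * tau 1%N)) <= 1.
Proof.
rewrite /step_size mulrC ler_pdivrMr ?mul1r ?mulr_gt0 ?ltr_wpDl//.
by rewrite ler_wpM2l// lerDl.
Qed.

Lemma step_size_cvg0 : step_size n @[n --> \oo] --> 0.
Proof.
have -> : step_size = (fun n => (K * tau 1%N + 1)^-1 * n.+1%:R^-1).
  by apply/funext => n; rewrite /step_size invfM mulrC.
have -> : 0 = (K * tau 1%N + 1)^-1 * 0 :> R by rewrite mulr0.
by apply: cvgM; [exact: cvg_cst|exact: cvg_harmonic].
Qed.

Lemma cutoff_supported n : supported n (cutoff n).
Proof. by move=> j nj; rewrite /cutoff ltnNge nj. Qed.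

Lemma cutoff_dominated n : dominated tau (cutoff n).
Proof.
split=> [j j0|m p m0].
  by rewrite /cutoff; case: ifP => // _; exact: dominated_ge0 dc0 _ j0.
apply: le_trans (dc0.2 m p m0).
apply: ler_sum_nat => j /andP[mj _]; rewrite ler_wpM2l// /cutoff.
by case: ifP => // _; apply: dominated_ge0 dc0 _ (leq_trans m0 mj).
Qed.

Lemma approx_dominated n t : dominated tau (approx n t).
Proof.
apply: (euler_dominated _ _ _ _ _ K0 a_ge0 a_le (ltW (step_size_gt0 n))
  (step_size_stable n)).
  exact: cutoff_supported.
exact: cutoff_dominated.
Qed.

Lemma approx_lipschitz n (s t : R) j : (0 < j)%N -> s <= t ->
  `|approx n t j - approx n s j| <= (t - s + step_size n) * L.
Proof.
move=> j0 st; have h0 := step_size_gt0 n.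
apply: le_trans (euler_lipschitz _ _ _ _ _ K0 a_ge0 a_le (ltW h0)
  (step_size_stable n) _ (cutoff_supported _) (cutoff_dominated _) _ _ _ j0
  (truncn_div_le _ _ _ h0 st)) _.
by rewrite ler_wpM2r// truncn_div_subr_le.
Qed.

(** The speed bound [L] is common to all components, so over a short window the iterates stay within
    [d] of each other componentwise and [rate_modulus] keeps the rate nearly constant. [elapsed] is
    the time between grid nodes, not [t - s]. *)
Lemma approx_increment j (e : R) : (0 < j)%N -> 0 < e ->
  exists2 d : R, 0 < d & forall n (s u t : R), s <= u <= t ->
    (t - s + step_size n) * L <= d ->
    let elapsed :=
      (Num.truncn (t / step_size n) - Num.truncn (s / step_size n))%:R
      * step_size n in
    `|approx n t j - approx n s j - elapsed * rate a n.+1 (approx n u) j|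
    <= elapsed * e.
Proof.
move=> j0 e0.
have [M [d d0 Hd]] := rate_modulus a K K0 a_ge0 a_le tau j _ tau0 j0 e0.
exists d => // n s u t /andP[su ut] std.
have h0 := step_size_gt0 n; have hN := step_size_stable n.
have dom i := euler_dominated _ _ _ _ _ K0 a_ge0 a_le (ltW h0) hN _
  (cutoff_supported _) (cutoff_dominated _) i.
have lip i1 i2 k := euler_lipschitz _ _ _ _ _ K0 a_ge0 a_le (ltW h0) hN _
  (cutoff_supported _) (cutoff_dominated _) i1 i2 k.
have tsu := truncn_div_le _ _ _ h0 su; have tut := truncn_div_le _ _ _ h0 ut.
have st := le_trans su ut.
apply: (euler_increment _ _ _ (ltW h0)) => //; first by rewrite tsu.
move=> l /andP[sl lt_]; apply: Hd => // k /andP[k0 _].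
have bound i1 i2 : (Num.truncn (s / step_size n) <= i1 <= i2)%N ->
    (i2 <= Num.truncn (t / step_size n))%N ->
    `|euler a n.+1 (step_size n) (cutoff n.+1) i2 k
      - euler a n.+1 (step_size n) (cutoff n.+1) i1 k| <= d.
  move=> /andP[si1 i12] i2t; apply: le_trans (lip _ _ _ k0 i12) _.
  apply: le_trans std; rewrite ler_wpM2r//.
  apply: le_trans (truncn_div_subr_le _ _ _ h0 st).
  by rewrite ler_wpM2r ?(ltW h0)// ler_nat leq_sub.
have [lu|ul] := leqP l (Num.truncn (u / step_size n)).
  by rewrite distrC bound// sl.
by rewrite bound ?tsu ?(ltnW ul) ?(ltnW lt_).
Qed.

Variable U : set_system nat.
Hypothesis UU : UltraFilter U.
Hypothesis Uoo : \oo `<=` U.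

Definition limit_sol (t : R) (j : nat) : R := lim (approx n t j @[n --> U]).

Lemma limit_sol_cvg t j : (0 < j)%N ->
  approx n t j @[n --> U] --> limit_sol t j.
Proof.
move=> j0; apply: (ultra_bounded_cvg U (fun n => approx n t j) 0 (tau 1%N)) => n.
have dn := approx_dominated n t.
by rewrite (dominated_ge0 _ _ dn)// (dominated_le _ _ dn).
Qed.

Lemma limit_sol_init j : (0 < j)%N -> limit_sol 0 j = c0 j.
Proof.
move=> j0; apply: cvg_lim => //; apply: (@cvg_near_cst _ _ (c0 j)).
(* From [n = j] on, the cutoff at [n.+1] leaves component [j] intact. *)
apply: Uoo; exists j => // n /= jn.
by rewrite /approx mul0r truncn0 /= /cutoff ltnS jn.
Qed.

Lemma limit_sol_dominated t : dominated tau (limit_sol t).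
Proof.
split=> [j j0|m p m0].
  apply: (ler_cvg_to (cvg_cst 0) (limit_sol_cvg t _ j0)).
  apply: nearW => n; exact: dominated_ge0 (approx_dominated n t) _ j0.
apply: (@ler_cvg_to _ U _ _ (fun n => \sum_(m <= j < p) j%:R * approx n t j)
  (fun=> tau m)).
- rewrite big_nat_cond; under eq_fun do rewrite big_nat_cond.
  apply: cvg_big => [|j]; first exact: add_continuous.
  rewrite andbT => /andP[mj _].
  by apply: cvgM; [exact: cvg_cst|apply: limit_sol_cvg; apply: leq_trans mj].
- exact: cvg_cst.
- by apply: nearW => n; exact: (approx_dominated n t).2.
Qed.

Let step_cvg : step_size n @[n --> U] --> 0.
Proof. by apply: cvg_trans step_size_cvg0; apply: cvg_app. Qed.

(** The rounding error [step_size n] in [approx_lipschitz] vanishes in the limit. *)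
Lemma limit_sol_lipschitz (s t : R) j : (0 < j)%N ->
  `|limit_sol t j - limit_sol s j| <= `|t - s| * L.
Proof.
move=> j0; wlog st : s t / s <= t => [wl|].
  have [/wl//|/ltW/wl] := leP s t.
  by rewrite distrC (distrC t).
rewrite [X in X * _]ger0_norm ?subr_ge0//.
apply: (@ler_cvg_to _ U _ _ (fun n => `|approx n t j - approx n s j|)
  (fun n => (t - s + step_size n) * L)).
- by apply: cvg_norm; apply: cvgB; exact: limit_sol_cvg.
- have -> : (t - s) * L = (t - s + 0) * L by rewrite addr0.
  apply: cvgM; last exact: cvg_cst.
  by apply: cvgD; [exact: cvg_cst|exact: step_cvg].
- by apply: nearW => n; exact: approx_lipschitz.
Qed.

Lemma limit_sol_continuous j : (0 < j)%N -> continuous (fun t => limit_sol t j).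
Proof.
move=> j0 t; apply/cvgrPdist_le => e e0.
near=> s; apply: le_trans (limit_sol_lipschitz _ _ _ j0) _.
(* Passing to [L + 1] allows the division below even if [L = 0]. *)
apply: (@le_trans _ _ (`|t - s| * (L + 1))).
  by rewrite ler_wpM2l// lerDl.
rewrite -ler_pdivlMr ?ltr_wpDl//.
near: s; apply: (@cvgr_dist_le _ _ _ _ _ id) => //.
by rewrite divr_gt0// ltr_wpDl.
Unshelve. all: by end_near. Qed.

Definition limit_rate (t : R) (j : nat) : R := full_rate a (limit_sol t) j.

(** One Lipschitz constant for all components gives the closeness that [rate_modulus] asks for; its
    bound, uniform in [p], survives the removal of the truncation. *)
Lemma limit_rate_continuous j : (0 < j)%N -> continuous (fun t => limit_rate t j).
Proof.
move=> j0 t; apply/cvgrPdist_le => e e0.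
have [M [d d0 Hd]] := rate_modulus a K K0 a_ge0 a_le tau j _ tau0 j0 e0.
near=> s; apply: (full_rate_le _ K tau K0 a_ge0 a_le) => //;
  [exact: limit_sol_dominated|exact: limit_sol_dominated|move=> p].
apply: Hd; [exact: limit_sol_dominated|exact: limit_sol_dominated|].
move=> k /andP[k0 _]; apply: le_trans (limit_sol_lipschitz _ _ _ k0) _.
apply: (@le_trans _ _ (`|t - s| * (L + 1))).
  by rewrite ler_wpM2l// lerDl.
rewrite -ler_pdivlMr ?ltr_wpDl//.
near: s; apply: (@cvgr_dist_le _ _ _ _ _ id) => //.
by rewrite divr_gt0// ltr_wpDl.
Unshelve. all: by end_near. Qed.

Lemma limit_sol_increment j (e : R) : (0 < j)%N -> 0 < e ->
  exists2 d : R, 0 < d & forall s u t : R, 0 <= s -> s <= u <= t ->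
    t - s <= d ->
    `|limit_sol t j - limit_sol s j - (t - s) * limit_rate u j| <= (t - s) * e.
Proof.
move=> j0 e0; have [d d0 Hd] := approx_increment j e j0 e0.
(* Half of the room goes to the window [t - s], half to the step size, which is eventually as
   small. *)
exists (d / 2 / (L + 1)); first by rewrite !divr_gt0// ltr_wpDl.
move=> s u t s0 sut std; have st : s <= t by case/andP: sut => /le_trans; apply.
pose elapsed n := (Num.truncn (t / step_size n) - Num.truncn (s / step_size n))%:R
  * step_size n.
(* Rounding changes the elapsed time by at most one step in either direction. *)
have ce : elapsed n @[n --> U] --> t - s.
  apply/cvgrPdist_le => r r0.
  move/cvgrPdist_le : step_cvg => /(_ r r0); apply: filterS => n.
  rewrite sub0r normrN => hr.
  have h0 := step_size_gt0 n; rewrite ger0_norm ?(ltW h0)// in hr.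
  have := truncn_div_subr_le _ _ _ h0 st.
  have := truncn_div_subr_ge _ _ _ h0 st s0.
  by rewrite -/(elapsed n) ler_norml => h1 h2; apply/andP; split; lra.
apply: (@ler_cvg_to _ U _ _
  (fun n => `|approx n t j - approx n s j
              - elapsed n * rate a n.+1 (approx n u) j|)
  (fun n => elapsed n * e)).
- apply: cvg_norm; apply: cvgB.
    by apply: cvgB; exact: limit_sol_cvg.
  apply: cvgM => //.
  apply: (rate_cvg_full_rate _ K tau K0 a_ge0 a_le) => //.
  + by move=> n; exact: approx_dominated.
  + exact: limit_sol_dominated.
  + by move=> k k0; exact: limit_sol_cvg.
- by apply: cvgM => //; exact: cvg_cst.
- have r0 : 0 < d / 2 / (L + 1) by rewrite !divr_gt0// ltr_wpDl.
  move/cvgrPdist_le : step_cvg => /(_ _ r0); apply: filterS => n.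
  rewrite sub0r normrN => /(le_trans (ler_norm _)) hr.
  apply: Hd => //.
  apply: (@le_trans _ _ ((d / 2 / (L + 1) + d / 2 / (L + 1)) * (L + 1))).
    apply: ler_pM => //; [|by lra|by rewrite lerDl].
    by have := step_size_gt0 n; lra.
  by rewrite mulrDl divfK -?splitr// gt_eqF// ltr_wpDl.
Qed.

Lemma limit_sol_derive j (t : R) : (0 < j)%N -> 0 < t ->
  is_derive t (1 : R) (fun s : R => limit_sol s j) (limit_rate t j).
Proof.
move=> j0 t0.
suff H : (fun h : R => h^-1 *: (limit_sol (h *: (1 : R) + t) j - limit_sol t j))
    @ 0^' --> limit_rate t j.
  split; first by apply/cvg_ex; exists (limit_rate t j).
  exact: cvg_lim H.
apply/cvgrPdist_le => e e0.
have [d d0 Hd] := limit_sol_increment j e j0 e0.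
have near0 (r : R) : 0 < r -> \forall h \near (0 : R)^', `|h| <= r.
  move=> r0; apply: nbhs_dnbhs.
  apply: filterS (nbhs0_lt r0) => x; exact: ltW.
near=> h; rewrite scaler1.
have hn0 : h != 0 by near: h; exact: nbhs_dnbhs_neq.
have hd : `|h| <= d by near: h; exact: near0.
have ht : `|h| <= t by near: h; exact: near0.
have key : `|limit_sol (h + t) j - limit_sol t j - h * limit_rate t j| <= `|h| * e.
  (* The reference time [t] is the left end of the window for [h >= 0] and the right end for
     [h < 0]; in the latter case [ht] keeps [h + t] nonnegative. *)
  have [h0|h0] := leP 0 h.
    rewrite (ger0_norm h0) in hd ht *.
    have := Hd t t (h + t); rewrite addrK lexx lerDr.
    by apply => //; exact: ltW.
  rewrite (ltr0_norm h0) in hd ht *.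
  have ht0 : 0 <= h + t by lra.
  have := Hd (h + t) t t ht0; rewrite lexx andbT gerDr (ltW h0) => /(_ isT).
  rewrite (_ : t - (h + t) = - h); last by ring.
  move=> /(_ hd).
  rewrite -normrN; congr (`|_| <= _); ring.
rewrite distrC -(ler_pM2l (_ : 0 < `|h|)) ?normr_gt0//.
by rewrite -normrM mulrBr /GRing.scale/= mulVKf.
Unshelve. all: by end_near. Qed.

End Limit.

(** * The norm of index 1, domination and integrability *)

Lemma Xnorm1E {R : realType} (x : nat -> R) :
  Xnorm 1 x = (\sum_(1 <= j <oo) (j%:R * `|x j|)%:E)%E.
Proof.
rewrite /Xnorm; congr (limn _); apply/funext => p.
by under eq_bigr do rewrite powRr1//.
Qed.

(** The bound [tau m] is the tail of the convergent norm series; its term at index 0 is zero because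
    of the factor [j]. *)
Lemma Xplus_dominated {R : realType} (x : nat -> R) : Xplus 1 x ->
  exists2 tau : nat -> R, tau @ \oo --> 0 & dominated tau x.
Proof.
move=> [Xx x0]; rewrite /X/= Xnorm1E in Xx.
pose f j := (j%:R * `|x j|)%:E : \bar R.
have f0 j : (0 <= f j)%E by rewrite lee_fin mulr_ge0.
have f0oo : (\sum_(0 <= j <oo) f j < +oo)%E.
  by rewrite (nneseries_split 0 1)// big_nat1 /f mul0r add0e.
have tail_fin m : (\sum_(m <= j <oo) f j)%E \is a fin_num.
  rewrite ge0_fin_numE ?nneseries_ge0//.
  apply: le_lt_trans f0oo; rewrite (nneseries_split 0 m)// add0n leeDr//.
  exact: sume_ge0.
exists (fun m => fine (\sum_(m <= j <oo) f j)%E).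
  apply: fine_cvg; apply: nneseries_tail_cvg => //.
split=> // m p m0; rewrite -lee_fin fineK//.
have [pm|mp] := leqP p m; first by rewrite big_geq// nneseries_ge0.
rewrite (nneseries_split m (p - m))// subnKC ?(ltnW mp)//.
rewrite -sumEFin.
apply: (@le_trans _ _ (\sum_(m <= j < p) f j)%E); last first.
  by rewrite leeDl// nneseries_ge0.
rewrite le_eqVlt; apply/orP; left; apply/eqP.
apply: eq_big_nat => j /andP[mj _].
by rewrite /f ger0_norm// x0// (leq_trans m0).
Qed.

Lemma dominated_Xnorm1_le {R : realType} (tau x : nat -> R) :
  dominated tau x -> (Xnorm 1 x <= (tau 1%N)%:E)%E.
Proof.
move=> dx; rewrite Xnorm1E; apply: lime_le.
  by apply: is_cvg_nneseries => j _ _; rewrite lee_fin mulr_ge0.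
apply: nearW => p; rewrite sumEFin lee_fin.
apply: le_trans (dx.2 1%N p isT).
by apply: ler_sum_nat => j /andP[j0 _]; rewrite ger0_norm ?(dominated_ge0 _ _ dx).
Qed.

Lemma dominated_Xplus {R : realType} (tau x : nat -> R) :
  dominated tau x -> Xplus 1 x.
Proof.
move=> dx; split; last exact: dx.1.
by apply: le_lt_trans (dominated_Xnorm1_le _ _ dx) _; exact: ltry.
Qed.

(** The partial sums are at most [K * j * tau 1], a constant in time, over an interval of finite
    length. *)
Lemma rate_integrable {R : realType} (a : nat -> nat -> R) (K : R)
    (tau : nat -> R) (c : R -> nat -> R) j (t : R) :
  0 <= K ->
  (forall j k : nat, (0 < j)%N -> (0 < k)%N -> 0 <= a j k) ->
  (forall j k : nat, (0 < j)%N -> (0 < k)%N -> a j k <= K * j%:R * k%:R) ->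
  (forall k, (0 < k)%N -> continuous (fun s => c s k)) ->
  (forall s, dominated tau (c s)) -> (0 < j)%N ->
  (\int[lebesgue_measure]_(s in `[0%R, t])
       (\sum_(1 <= k <oo) (a j k * c s k)%:E) < +oo)%E.
Proof.
move=> K0 a_ge0 a_le cc dc j0.
have term0 s k : (0 < k)%N -> (0 <= (a j k * c s k)%:E)%E.
  by move=> k0; rewrite lee_fin mulr_ge0 ?a_ge0 ?(dominated_ge0 _ _ (dc s)).
pose B := K * j%:R * tau 1%N.
have B0 : 0 <= B.
  by rewrite !mulr_ge0// (dominated_tau_ge0 _ _ (dc 0)).
apply: (@le_lt_trans _ _ (\int[lebesgue_measure]_(s in `[0%R, t]) (cst B%:E s))%E).
  apply: ge0_le_integral => //.
  - by move=> s _; apply: nneseries_ge0 => k k0 _; exact: term0.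
  - have -> : (fun s => \sum_(1 <= k <oo) (a j k * c s k)%:E)%E =
        (fun s => \sum_(0 <= k <oo | (0 < k)%N) (a j k * c s k)%:E)%E.
      apply/funext => s; congr (limn _); apply/funext => p.
      exact: (@big_nat_widenl _ _ _ 1 0).
    apply: ge0_emeasurable_sum => [k s _ k0|k k0]; first exact: term0.
    apply/measurable_EFinP; apply: measurable_funTS.
    apply: continuous_measurable_fun => s.
    by apply: cvgM; [exact: cvg_cst|exact: cc].
  - move=> s _; apply: lime_le.
      by apply: is_cvg_nneseries => k k0 _; exact: term0.
    apply: nearW => p; rewrite sumEFin lee_fin.
    apply: (@le_trans _ _ (K * j%:R * \sum_(1 <= k < p) k%:R * c s k)).
      rewrite mulr_sumr; apply: ler_sum_nat => k /andP[k0 _].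
      by rewrite mulrA ler_wpM2r ?a_le// (dominated_ge0 _ _ (dc s)).
    by rewrite ler_wpM2l ?mulr_ge0// (dc s).2.
rewrite integral_cst//= lebesgue_measure_itv/=.
by case: ifP => _; rewrite ?mule0 ?ltry// -EFinB -EFinM ltry.
Qed.

(** * Assembly of a global solution *)

Theorem theorem3p1 (R : realType) (a : nat -> nat -> R)
  (a_sym : forall j k : nat, (0 < j)%N -> (0 < k)%N -> a j k = a k j)
  (a_ge0 : forall j k : nat, (0 < j)%N -> (0 < k)%N -> 0 <= a j k)
  (a_bound : exists2 K : R, 0 < K &
    forall j k : nat, (0 < j)%N -> (0 < k)%N -> a j k <= K * j%:R * k%:R)
  (c0 : nat -> R) (c0_Xplus : Xplus 1 c0) :
  exists2 T : \bar R, (0 < T)%E &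
    exists c : R -> nat -> R, rbk_solution a c0 T c.
Proof.
have [K /ltW K0 a_le] := a_bound.
have [tau tau0 dc0] := Xplus_dominated _ c0_Xplus.
have [U [UU Uoo]] := ultraFilterLemma (eventually_filter : ProperFilter \oo).
pose c := limit_sol a K tau c0 U.
have dc t : dominated tau (c t) by exact: limit_sol_dominated.
have cc j : (0 < j)%N -> continuous (fun t => c t j).
  by move=> j0; exact: (limit_sol_continuous _ _ _ _ K0 a_ge0 a_le dc0).
(* All bounds are uniform in time, so nothing limits the interval of existence. *)
exists +oo%E => //; exists c; split.
- by move=> j j0; exact: limit_sol_init.
- by move=> t _; exact: dominated_Xplus (dc t).
- by move=> j j0; apply: continuous_subspaceT; exact: cc.
- apply: (@le_lt_trans _ _ (tau 1%N)%:E); last exact: ltry.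
  by apply: ge_ereal_sup => _ [t _ <-]; exact: dominated_Xnorm1_le (dc t).
- by move=> j t j0 _; exact: (rate_integrable _ K tau).
move=> j t j0 [t0 _].
(* The integrand becomes the real, continuous function [limit_rate]. *)
under eq_integral => s _ do
  rewrite (rate_cvg_rbk_rhs _ K tau K0 a_ge0 a_le _ _ (dc s) j0).2.
rewrite -(limit_sol_init a K tau c0 U UU Uoo j j0) -/c.
(* The fundamental theorem of calculus needs a nondegenerate interval, so [t = 0] is settled
   apart. *)
move: t0; rewrite le_eqVlt => /predU1P[<-|t0].
  by rewrite set_itv1 integral_set1 adde0.
rewrite (continuous_FTC2 (F := fun s => c s j) t0).
- by rewrite -EFinB -EFinD addrC subrK.
- apply: continuous_subspaceT.
  exact: (limit_rate_continuous _ K tau c0 K0 a_ge0 a_le tau0 dc0).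
- split=> [s||].
  + rewrite in_itv/= => /andP[s0 _].
    by have [] := limit_sol_derive _ _ _ _ K0 a_ge0 a_le tau0 dc0 _ UU Uoo _ _ j0 s0.
  + by apply: cvg_at_right_filter; exact: cc.
  + by apply: cvg_at_left_filter; exact: cc.
- move=> s; rewrite in_itv/= => /andP[s0 _].
  have [_ ds] := limit_sol_derive _ _ _ _ K0 a_ge0 a_le tau0 dc0 _ UU Uoo _ _ j0 s0.
  by rewrite derive1E ds.
Qed.
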